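(* For all integers $n\geq 0$, $$a_{1^{2}2^{-1}4^{-1}}(4n)>0,\qquad a_{1^{2}2^{-1}4^{-1}}(4n+1)<0,\qquad a_{1^{2}2^{-1}4^{-1}}(4n+2)=a_{1^{2}2^{-1}4^{-1}}(4n+3)=0.$$
   Context: For $|q|<1$ (or as formal power series in $q$) let $f_j:=(q^j;q^j)_\infty=\prod_{k\ge 1}(1-q^{jk})$ for each positive integer $j$. The integers $a_{1^{2}2^{-1}4^{-1}}(n)$, $n\ge 0$, are defined by $\sum_{n=0}^\infty a_{1^{2}2^{-1}4^{-1}}(n)q^n=\dfrac{f_1^2}{f_2f_4}$. *)

(* Defs.v *)
From mathcomp Require Import all_boot all_order all_algebra.
Set Implicit Arguments.
Unset Strict Implicit.
Unset Printing Implicit Defensive.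
Import Order.TTheory GRing.Theory Num.Theory.
Local Open Scope ring_scope.

(* A formal power series \sum_n a n * q^n with integer coefficients is given by
   its coefficient function. *)
Definition fps := nat -> int.

Definition fps_one : fps := fun n => (n == 0)%N%:R.

Definition fps_mul (a b : fps) : fps :=
  fun n => \sum_(i < n.+1) a i * b (n - i)%N.

(* The first n.+1 coefficients of the multiplicative inverse of a series a whose
   constant term is invertible, obtained by solving a * b = 1 degree by degree:
   b_0 = a_0^-1 and b_n = - a_0^-1 * \sum_(i < n) a_(n-i) * b_i. *)
Fixpoint fps_inv_seq (a : fps) (n : nat) : seq int :=
  if n is m.+1 then
    let s := fps_inv_seq a m in
    rcons s (- (a 0%N)^-1 * \sum_(i < m.+1) a (m.+1 - i)%N * s`_i)
  else [:: (a 0%N)^-1].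

Definition fps_inv (a : fps) : fps := fun n => (fps_inv_seq a n)`_n.

Definition fps_div (a b : fps) : fps := fps_mul a (fps_inv b).

(* f_j = (q^j; q^j)_oo, for j > 0.  The factors with k > n only affect degrees
   larger than n, so the coefficient of q^n is read off the finite product over
   1 <= k <= n (see f_stable). *)
Definition f (j : nat) : fps :=
  fun n => (\prod_(1 <= k < n.+1) (1 - 'X^(j * k)) : {poly int})`_n.

(* The coefficient sequence of f_1^2 / (f_2 f_4). *)
Definition a_1p2_2m1_4m1 : fps :=
  fps_div (fps_mul (f 1) (f 1)) (fps_mul (f 2) (f 4)).

Lemma f_stable (j n N : nat) : (0 < j)%N -> (n <= N)%N ->
  (\prod_(1 <= k < N.+1) (1 - 'X^(j * k)) : {poly int})`_n = f j n.
Proof.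
move=> j0 /subnK <-; elim: (N - n)%N => [|d IHd] //.
rewrite addSn big_nat_recr //= mulrBr mulr1 coefB IHd coefMXn ifT ?subr0 //.
by rewrite (leq_trans _ (leq_pmull _ j0)) // ltnS leq_addl.
Qed.

Lemma size_fps_inv_seq a n : size (fps_inv_seq a n) = n.+1.
Proof. by elim: n => //= n IHn; rewrite size_rcons IHn. Qed.

Lemma nth_fps_inv_seq a n i : (i <= n)%N -> (fps_inv_seq a n)`_i = fps_inv a i.
Proof.
move=> /subnK <-; elim: (n - i)%N => [|d IHd] //.
by rewrite addSn /= nth_rcons size_fps_inv_seq ltnS leq_addl IHd.
Qed.

Lemma fps_mulV (a : fps) : a 0%N \is a GRing.unit ->
  fps_mul a (fps_inv a) =1 fps_one.
Proof.
move=> a0 [|n]; rewrite /fps_mul /fps_one.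
  by rewrite big_ord1 /fps_inv /= mulrV.
rewrite big_ord_recl subn0 {1}/fps_inv /= nth_rcons size_fps_inv_seq ltnn eqxx.
rewrite mulrA mulrN mulrV // mulN1r addrC.
apply/eqP; rewrite subr_eq0; apply/eqP; rewrite (reindex_inj rev_ord_inj) /=.
apply: eq_bigr => i _; rewrite nth_fps_inv_seq -1?ltnS //.
have li : (i <= n)%N by rewrite -ltnS ltn_ord.
by rewrite /= /bump add1n subSS -subSn // subKn // leqW.
Qed.

Lemma f_const j : f j 0%N = 1.
Proof. by rewrite /f big_geq // coef1. Qed.

Lemma f2f4_unit : fps_mul (f 2) (f 4) 0%N \is a GRing.unit.
Proof. by rewrite /fps_mul big_ord1 !f_const. Qed.

(* Main.v *)
Require Import Defs.
From mathcomp Require Import all_boot all_order all_algebra.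
From mathcomp Require Import ring zify.
Import Order.TTheory GRing.Theory Num.Theory.
Local Open Scope ring_scope.

(** By Gauss, [f_1^2 / f_2 = \sum_(k in Z) (-1)^k q^(k^2)], so that the series
    is [(1 + 2 \sum_(k > 0) (-1)^k q^(k^2)) / f_4].  Here [1 / f_4] is a series
    in [q^4] whose coefficients are the (positive) partition numbers, and [k^2]
    is 0 or 1 modulo 4 according to the parity of [k], which is also the sign
    of the term: hence the degrees 0 mod 4 only receive nonnegative terms, the
    degrees 1 mod 4 only nonpositive ones and the other degrees none.

    Gauss's identity is obtained from a finite form in the style of Shanks:
    with [D_n = \prod_(1 <= k <= n) (1 + q^k)],
    [D_n (1 + 2 \sum_(1 <= k <= n) (-1)^k q^(k^2))] is the sum over [0 <= s <= n]
    of [shanks_term n s], which is [(q; q)_n] for [s = 0] and a multiple of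
    [q^(n+1)] for [s > 0]. *)

Section FiniteGauss.
Variables (R : comNzRingType) (q : R).

Definition shanks_term (n s : nat) : R :=
  (-1) ^+ s * q ^+ (n.+1 * s) * \prod_(s.+1 <= k < n.+1) (1 - q ^+ k)
  * \prod_(0 <= k < s) (1 + q ^+ k).

(** Sum of (-1)^k q^(k^2) over |k| <= n, with k and -k merged. *)
Definition theta (n : nat) : R :=
  1 + \sum_(1 <= k < n.+1) 2 * (-1) ^+ k * q ^+ (k ^ 2).

(** Since D_(n+1) = (1 + q^(n+1)) D_n, these differences drive the induction in [finite_gauss]; they
    telescope in s and leave one boundary term. *)
Lemma shanks_telescope n m : (m <= n)%N ->
  \sum_(0 <= s < m.+1)
     (shanks_term n.+1 s - (1 + q ^+ n.+1) * shanks_term n s) =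
  - ((-1) ^+ m * q ^+ (n.+1 * m.+1) * \prod_(m.+1 <= k < n.+1) (1 - q ^+ k)
     * \prod_(0 <= k < m.+1) (1 + q ^+ k)).
Proof.
elim: m => [|m IHm] lemn.
  rewrite !big_nat1 /shanks_term !(@big_geq _ _ _ 0 0) // !muln0 muln1.
  rewrite (@big_nat_recr _ _ _ n.+1) //=.
  ring.
rewrite big_nat_recr //= (IHm (ltnW lemn)) /shanks_term.
rewrite (big_nat_recr n.+1) //= (big_ltn (m := m.+1)) //.
rewrite (big_nat_recr m.+1) //= !(mulSn n.+1) (mulnS n.+1 m.+1) !exprD.
rewrite (exprS (-1)).
move: (_ * _)%N (q ^+ m.+1) (q ^+ n.+1) => e x y.
ring.
Qed.

Lemma finite_gauss n :
  \sum_(0 <= s < n.+1) shanks_term n s =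
  \prod_(1 <= k < n.+1) (1 + q ^+ k) * theta n.
Proof.
elim: n => [|n IHn].
  by rewrite /shanks_term /theta big_nat1 !big_geq // muln0 addr0 !mulr1.
have := @shanks_telescope n n (leqnn n).
rewrite big_split /= sumrN -mulr_sumr IHn => /(canRL (subrK _)) tele.
rewrite big_nat_recr //= tele /theta /shanks_term.
rewrite [X in _ = X * _]big_nat_recr //= [X in _ = _ * (_ + X)]big_nat_recr //=.
(* The boundary term and the new term s = n+1 combine into a multiple of 1 + q^(n+1); the factor 1 +
   q^0 = 2 supplies the coefficient 2 of [theta]. *)
rewrite !(@big_ltn _ _ _ 0) // (@big_geq _ _ _ n.+1 n.+1) //.
rewrite (@big_geq _ _ _ n.+2 n.+2) // -mulnn (mulSn n.+1) exprD (exprS (-1)).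
move: (_ * _)%N (q ^+ n.+1) => e x.
ring.
Qed.

End FiniteGauss.

(** Congruence modulo q^(N+1), which moves identities of series into the polynomial ring. *)
Definition eq_upto (N : nat) (p r : {poly int}) :=
  forall i, (i <= N)%N -> p`_i = r`_i.

Lemma eq_uptoM N p p' r r' :
  eq_upto N p p' -> eq_upto N r r' -> eq_upto N (p * r) (p' * r').
Proof.
move=> ep er i lein; rewrite !coefM; apply: eq_bigr => j _.
by rewrite ep ?er //; have := ltn_ord j; lia.
Qed.

Lemma eq_upto_refl N p : eq_upto N p p. Proof. by []. Qed.

Lemma eq_upto_sym {N p r} : eq_upto N p r -> eq_upto N r p.
Proof. by move=> epr i /epr. Qed.

Lemma eq_upto_trans {N p r s} : eq_upto N p r -> eq_upto N r s -> eq_upto N p s.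
Proof. by move=> epr ers i lein; rewrite epr ?ers. Qed.

Lemma eq_upto_addXn N m p r : (N < m)%N -> eq_upto N (p + 'X^m * r) p.
Proof.
by move=> ltNm i lein; rewrite coefD coefXnM (leq_ltn_trans lein ltNm) addr0.
Qed.

Definition trunc_fps (N : nat) (a : fps) : {poly int} := \poly_(i < N.+1) a i.

Lemma coef_trunc_fps N a i : (i <= N)%N -> (trunc_fps N a)`_i = a i.
Proof. by move=> lein; rewrite coef_poly ltnS lein. Qed.

Lemma trunc_fpsM N a b :
  eq_upto N (trunc_fps N (fps_mul a b)) (trunc_fps N a * trunc_fps N b).
Proof.
move=> i lein; rewrite coef_trunc_fps // coefM; apply: eq_bigr => j _.
by rewrite !coef_trunc_fps //; have := ltn_ord j; lia.
Qed.

Definition euler_poly (j N : nat) : {poly int} :=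
  \prod_(1 <= k < N.+1) (1 - 'X^(j * k)).

Lemma trunc_f j N : (0 < j)%N -> eq_upto N (trunc_fps N (f j)) (euler_poly j N).
Proof. by move=> j0 i lein; rewrite coef_trunc_fps // -(@f_stable j i N). Qed.

Lemma euler_poly_comp j N : (0 < j)%N ->
  euler_poly j N = euler_poly 1 N \Po 'X^j.
Proof.
move=> j0; rewrite /euler_poly rmorph_prod /=; apply: eq_bigr => k _.
by rewrite rmorphB rmorph1 /= comp_Xn_poly mul1n exprM.
Qed.

(** As 1 - q^(2k) = (1 + q^k)(1 - q^k), the truncated f_2 is D_N times the truncated f_1;
    [finite_gauss] then expands D_N times [theta]. *)
Lemma gauss_upto N :
  eq_upto N (euler_poly 1 N * euler_poly 1 N)
            (theta {poly int} 'X N * euler_poly 2 N).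
Proof.
have -> : euler_poly 2 N =
    \prod_(1 <= k < N.+1) (1 + 'X^k) * euler_poly 1 N.
  rewrite /euler_poly -big_split /=; apply: eq_bigr => k _.
  by rewrite mul1n mul2n -addnn exprD; ring.
rewrite mulrA [theta _ _ _ * _]mulrC -finite_gauss.
apply: eq_uptoM (@eq_upto_refl _ _); apply: eq_upto_sym.
rewrite big_nat_recl // {1}/shanks_term muln0 (@big_geq _ _ _ 0 0) //.
rewrite !mulr1 mul1r.
(* The index is shifted, so every remaining term yields a factor q^(N+1). *)
under [\sum_(_ <= _ < _) _]eq_bigr => s _.
  rewrite /shanks_term mulnS exprD [(-1) ^+ _ * (_ * _)]mulrCA -!mulrA.
  over.
rewrite -mulr_sumr (_ : \prod_(_ <= k < _) _ = euler_poly 1 N).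
  exact: eq_upto_addXn.
by apply: eq_bigr => k _; rewrite mul1n.
Qed.

(** Agrees with 1 / f_1 up to degree N, where parts and multiplicities above N do not occur. *)
Definition partition_poly (N : nat) : {poly int} :=
  \prod_(1 <= k < N.+1) \sum_(i < N.+1) ('X^k) ^+ i.

(** Each factor 1 - q^k times its geometric sum is 1 - q^(k(N+1)), with k >= 1. *)
Lemma mul_euler_partition N : eq_upto N (euler_poly 1 N * partition_poly N) 1.
Proof.
rewrite -big_split /= big_nat.
apply: (big_ind (fun p => eq_upto N p 1)) => [//|p r ep er|k /andP[k0 _]].
  by rewrite -[1]mulr1; apply: eq_uptoM.
rewrite mul1n -opprB mulNr -subrX1 opprB -exprM -mulrN1.
by apply: eq_upto_addXn; rewrite leq_pmull.
Qed.

Lemma geometric_nneg N k :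
  \sum_(i < N) ('X^k) ^+ i \is a @polyOver int Num.Def.nneg_num_pred.
Proof. by apply: rpred_sum => i _; rewrite !rpredX ?polyOverX. Qed.

Lemma partition_poly_nneg N : 
  partition_poly N \is a @polyOver int Num.Def.nneg_num_pred.
Proof. by apply: rpred_prod => k _; apply: geometric_nneg. Qed.

(** The partition of i into ones already counts: the factor k = 1 has coefficient 1 in degree i, and
    the other factors have nonnegative coefficients and constant term 1. *)
Lemma partition_poly_gt0 N i : (i <= N)%N -> (0 < N)%N ->
  0 < (partition_poly N)`_i.
Proof.
move=> lein N0; rewrite /partition_poly big_ltn //.
set A := \sum_(_ < _) _; set B := \prod_(_ <= _ < _) _.
have A_nneg : A \is a polyOver Num.Def.nneg_num_pred by apply: geometric_nneg.
have B_nneg : B \is a polyOver Num.Def.nneg_num_pred.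
  by apply: rpred_prod => k _; apply: geometric_nneg.
have B0 : B`_0 = 1.
  rewrite coef0_prod big_nat big1 // => k /andP[k1 _].
  rewrite big_ord_recl coefD coef1 /= coef_sum big1 ?addr0 // => j _.
  by rewrite -exprM coefXn eq_sym muln_eq0 orbF; case: k k1.
have Ai : A`_i = 1.
  rewrite coef_sum (bigD1 (Ordinal (lein : i < N.+1)%N)) //= coefXn eqxx.
  rewrite big1 ?addr0 // => j; rewrite -val_eqE coefXn eq_sym /=.
  by move=> /negPf ->.
rewrite coefM big_ord_recr /= subnn Ai B0 mulr1 ltr_wpDl //.
apply: sumr_ge0 => j _; apply: mulr_ge0.
  exact: (polyOverP A_nneg).
exact: (polyOverP B_nneg).
Qed.

(** Modulo q^(N+1), [W] inverts f_2 f_4 and [G] inverts f_4, so f_1^2 [W] = [S] f_2 [W] = [S] f_2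
    [W] f_4 [G] = [S] [G]. *)
Lemma a_upto N :
  eq_upto N (trunc_fps N a_1p2_2m1_4m1)
            (theta {poly int} 'X N * (partition_poly N \Po 'X^4)).
Proof.
set W := trunc_fps N (fps_inv (fps_mul (f 2) (f 4))).
set G := _ \Po _; set S := theta _ _ _.
have W_inv : eq_upto N (euler_poly 2 N * euler_poly 4 N * W) 1.
  apply: eq_upto_trans (_ : eq_upto N
    (trunc_fps N (fps_mul (fps_mul (f 2) (f 4))
                          (fps_inv (fps_mul (f 2) (f 4))))) 1).
    apply: eq_upto_sym; apply: eq_upto_trans (@trunc_fpsM _ _ _) _.
    apply: eq_uptoM => //; apply: eq_upto_trans (@trunc_fpsM _ _ _) _.
    by apply: eq_uptoM; apply: trunc_f.
  by move=> i lein; rewrite coef_trunc_fps // (fps_mulV f2f4_unit) coef1.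
have G_inv : eq_upto N (euler_poly 4 N * G) 1.
  rewrite euler_poly_comp // -rmorphM /= => i lein.
  rewrite coef_comp_poly_Xn // coef1; case: ifPn => [/dvdnP[j ij]|].
    rewrite mul_euler_partition ?coef1; last by lia.
    by rewrite ij mulnK // muln_eq0 orbF.
  by case: i {lein}.
apply: eq_upto_trans (@trunc_fpsM _ _ _) _; rewrite -/W.
apply: (@eq_upto_trans _ _ (S * euler_poly 2 N * W)).
  apply: eq_uptoM => //; apply: eq_upto_trans (@gauss_upto N).
  by apply: eq_upto_trans (@trunc_fpsM _ _ _) _; apply: eq_uptoM; apply: trunc_f.
apply: (@eq_upto_trans _ _ (S * euler_poly 2 N * W * (euler_poly 4 N * G))).
  by rewrite -[X in eq_upto _ X]mulr1; apply: eq_uptoM => //; apply: eq_upto_sym.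
rewrite (_ : _ * _ = S * G * (euler_poly 2 N * euler_poly 4 N * W)); last ring.
by rewrite -[X in eq_upto _ _ X]mulr1; apply: eq_uptoM.
Qed.

Lemma coef_theta_mul N (p : {poly int}) i :
  (theta {poly int} 'X N * p)`_i =
  p`_i + \sum_(1 <= k < N.+1)
           2 * (-1) ^+ k * (if (i < k ^ 2)%N then 0 else p`_(i - k ^ 2)).
Proof.
rewrite mulrDl mul1r coefD mulr_suml coef_sum; congr (_ + _).
apply: eq_bigr => k _; rewrite -coefXnM -[_ * 'X^_ * _]mulrA.
have -> : 2 * (-1) ^+ k = (2 * (-1) ^+ k)%:P :> {poly int}.
  by rewrite rmorphM rmorphXn /= rmorphN1 rmorph_nat.
by rewrite coefCM.
Qed.

Theorem theorem4p6 (n : nat) :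
  [/\ 0 < a_1p2_2m1_4m1 (4 * n)%N,
      a_1p2_2m1_4m1 (4 * n + 1)%N < 0,
      a_1p2_2m1_4m1 (4 * n + 2)%N = 0
    & a_1p2_2m1_4m1 (4 * n + 3)%N = 0].
Proof.
(* The largest of the four degrees, so one truncation serves them all. *)
pose N := (4 * n + 3)%N; pose G := partition_poly N \Po 'X^4.
have aE i : (i <= N)%N -> a_1p2_2m1_4m1 i = G`_i + \sum_(1 <= k < N.+1)
    2 * (-1) ^+ k * (if (i < k ^ 2)%N then 0 else G`_(i - k ^ 2)).
  by move=> lein; rewrite -(@coef_trunc_fps N _ i lein) a_upto // coef_theta_mul.
have G0 i : ~~ (4 %| i)%N -> G`_i = 0.
  by rewrite coef_comp_poly_Xn // => /negPf ->.
have Gge0 i : 0 <= G`_i.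
  rewrite coef_comp_poly_Xn //; case: ifP => // _.
  exact: (polyOverP (partition_poly_nneg N)).
have Ggt0 : 0 < G`_(4 * n).
  rewrite coef_comp_poly_Xn // dvdn_mulr // mulKn //.
  by apply: partition_poly_gt0; rewrite /N; lia.
have sqr4 k : (k ^ 2 %% 4)%N = odd k.
  rewrite -{1}(odd_double_half k) -mul2n; case: (odd k) => /=.
    by rewrite (_ : (_ ^ 2 = (k./2 ^ 2 + k./2) * 4 + 1)%N) ?modnMDl //; lia.
  by rewrite (_ : (_ ^ 2 = k./2 ^ 2 * 4)%N) ?modnMl //; lia.
(* [G] lives in degrees divisible by 4, so k reaches degree i only when i and k^2 agree modulo 4. *)
have Gsq0 i k : (i %% 4 != odd k)%N ->
    (if (i < k ^ 2)%N then 0 else G`_(i - k ^ 2)) = 0.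
  move=> ne; case: ltnP => // le; apply: G0.
  by have := sqr4 k; move: ne; lia.
have Gsq_ge0 i k : 0 <= (if (i < k ^ 2)%N then 0 else G`_(i - k ^ 2)).
  by case: ifP.
split.
(* Strictness comes from the term k = 0, which is [G]_(4n). *)
- rewrite aE ?ltr_pwDl //; last by rewrite /N; lia.
  apply: sumr_ge0 => k _; have := Gsq_ge0 (4 * n)%N k.
  have [k_odd|k_even] := boolP (odd k).
    by rewrite Gsq0 ?mulr0 // k_odd; lia.
  by rewrite -signr_odd (negPf k_even) expr0 mulr1 => ?; rewrite mulr_ge0.
- rewrite aE; last by rewrite /N; lia.
  rewrite G0 ?add0r; last by lia.
  (* Strictness comes from the term k = 1, which is -2 [G]_(4n). *)
  rewrite big_ltn; last by rewrite /N; lia.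
  rewrite ifF; last by lia.
  rewrite addnK expr1 mulrN1 -[ltRHS]addr0 ltr_leD //.
    by rewrite mulNr oppr_lt0 mulr_gt0.
  apply: sumr_le0 => k _; have := Gsq_ge0 (4 * n + 1)%N k.
  have [k_odd|k_even] := boolP (odd k).
    by rewrite -signr_odd k_odd expr1 mulrN1 mulNr oppr_le0 => ?; rewrite mulr_ge0.
  by rewrite Gsq0 ?mulr0 // (negPf k_even); lia.
(* Neither 2 nor 3 is a square modulo 4, so every term vanishes in the last two cases. *)
- rewrite aE; last by rewrite /N; lia.
  rewrite G0 ?add0r; last by lia.
  by apply: big1 => k _; rewrite Gsq0 ?mulr0 //; case: (odd k); lia.
- rewrite aE //.
  rewrite G0 ?add0r; last by lia.
  by apply: big1 => k _; rewrite Gsq0 ?mulr0 //; case: (odd k); lia.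
Qed.
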